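(* Let $(T(t))_{t\ge0}$ be a bounded $C_0$-semigroup on a Banach space $E$ that is norm continuous at infinity. Then for all $n\in\mathbb{N}$ and $t_1,\dots,t_n\ge0$, $$\ker(T(t_1)-\mathrm{Id})\cdots(T(t_n)-\mathrm{Id})=\ker(T(t_1)-\mathrm{Id})+\cdots+\ker(T(t_n)-\mathrm{Id}).$$
   Context: With $\omega_0=\omega_0(T)=\inf\{\omega\in\mathbb{R}:\exists M,\ \|T(t)\|\le Me^{\omega t}\ \forall t\ge0\}$ the growth bound, the semigroup is norm continuous at infinity if $\lim_{t\to\infty}\limsup_{h\downarrow0}\|e^{-\omega_0t}T(t)(\mathrm{Id}-e^{-\omega_0h}T(h))\|=0$. *)

(* Defs.v *)
From HB Require Import structures.
From mathcomp Require Import all_boot all_order all_algebra.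
From mathcomp Require Import all_classical all_reals all_analysis.
Set Implicit Arguments. Unset Strict Implicit. Unset Printing Implicit Defensive.
Import Order.TTheory GRing.Theory Num.Theory.
Import numFieldNormedType.Exports.
Local Open Scope classical_set_scope.
Local Open Scope ring_scope.

Definition opnorm {R : realType} {E : normedModType R} (A : E -> E) : R :=
  sup [set `|A x| | x in [set x : E | `|x| <= 1]].

(* A C_0-semigroup (T(t))_{t>=0} of bounded linear operators on E;
   T is given on all of R but only its values for t >= 0 matter. *)
Definition C0_semigroup {R : realType} {E : normedModType R}
    (T : R -> {linear E -> E}) : Prop :=
  [/\ (forall t, 0 <= t -> continuous (T t)),
      (forall x, T 0 x = x),
      (forall s t x, 0 <= s -> 0 <= t -> T (s + t) x = T s (T t x)) &
      (forall x, T^~ x @ at_right 0 --> x)].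

Definition bounded_semigroup {R : realType} {E : normedModType R}
    (T : R -> {linear E -> E}) : Prop :=
  exists M : R, forall t, 0 <= t -> opnorm (T t) <= M.

Definition growth_bound {R : realType} {E : normedModType R}
    (T : R -> {linear E -> E}) : \bar R :=
  ereal_inf [set w%:E | w in [set w : R | exists M : R,
     forall t, 0 <= t -> opnorm (T t) <= M * expR (w * t)]].

(* Norm continuity at infinity:
   lim_{t->oo} limsup_{h↓0} ||e^{-w0 t} T(t)(Id - e^{-w0 h} T(h))|| = 0,
   written out in epsilon form (the integrand is nonnegative).
   When w0 = -oo the expression is meaningless; the condition is then
   imposed vacuously. *)
Definition norm_continuous_at_infinity {R : realType} {E : normedModType R}
    (T : R -> {linear E -> E}) : Prop :=
  forall w0 : R, growth_bound T = w0%:E ->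
  forall eps : R, 0 < eps -> exists t0 : R, forall t, t0 <= t ->
    exists delta : R, 0 < delta /\ forall h, 0 < h -> h < delta ->
      opnorm (fun x => expR (- w0 * t) *: T t (x - expR (- w0 * h) *: T h x))
        <= eps.

Definition opprod {E : Type} (n : nat) (A : 'I_n -> E -> E) : E -> E :=
  foldr (fun i g => A i \o g) id (enum 'I_n).

Definition kerset {R : realType} {E : normedModType R} (A : E -> E) : set E :=
  [set x | A x = 0].

Definition sumsets {R : realType} {E : normedModType R} (n : nat)
    (V : 'I_n -> set E) : set E :=
  [set x | exists y : 'I_n -> E, (forall i, V i (y i)) /\ x = \sum_(i < n) y i].

(* Main.v *)
(* Only the vectors of period b > 0 matter, and no spectral theory is needed.
   On G = ker (T(b) - Id) the semigroup is norm continuous at 0, since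
   T(kb) = Id on G.  For m large and h = b/m, averaging over the cyclic group
   generated by T(h) splits G into ker (T(h) - Id), which consists of vectors fixed
   by the whole semigroup, and a part on which T(h) - Id is boundedly invertible.
   Given a > 0, either a/b is rational, and T(a) has finite order on G, or some
   power of T(a) is norm close to T(h) on G and a Neumann series applies: in both
   cases every y in G is y' + (T(a) - Id) z with T(a) y' = y' and z in G.
   If a product of factors T(t_j) - Id kills x, then inductively (T(t_1) - Id) x is
   a sum of t_j-periodic y_j, j > 1; splitting them with a = t_1 shows that
   w = x - sum z_j has (T(t_1) - Id) w fixed by T(t_1), hence zero by boundedness. *)
Require Import Defs.
From HB Require Import structures.
From mathcomp Require Import all_boot all_order all_algebra.
From mathcomp Require Import all_classical all_reals all_analysis.
From mathcomp Require Import ring lra.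
Import Order.TTheory GRing.Theory Num.Theory.
Import numFieldNormedType.Exports.
Local Open Scope classical_set_scope.
Local Open Scope ring_scope.

(** * Operator norm bounds and iterative correction *)

(** [sup] takes the default value 0 on a set unbounded above, so some bound [C] must be known before
    [opnorm] means anything; rescaling to the unit sphere then gives the sharp estimate. *)
Lemma le_opnorm {R : realType} {E : normedModType R} (A : E -> E) (C : R) (x : E) :
  scalable A -> (forall y, `|A y| <= C * `|y|) -> `|A x| <= opnorm A * `|x|.
Proof.
move=> linA bndA.
have ubA : has_ubound [set `|A y| | y in [set y : E | `|y| <= 1]].
  exists `|C| => _ [y /= y1 <-]; apply: le_trans (bndA y) _.
  apply: le_trans (ler_norm _) _; rewrite normrM normr_id.
  exact: ler_piMr.
have [->|x0] := eqVneq x 0.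
  by move: (bndA 0); rewrite normr0 !mulr0.
have nx : 0 < `|x| by rewrite normr_gt0.
rewrite -ler_pdivrMr// mulrC.
have -> : `|x|^-1 * `|A x| = `|A (`|x|^-1 *: x)|.
  by rewrite linA normrZ ger0_norm ?invr_ge0.
apply: ub_le_sup => //; exists (`|x|^-1 *: x) => //=.
by rewrite normrZ ger0_norm ?invr_ge0// mulVf// gt_eqF.
Qed.

Lemma continuous_linear_le {R : realType} {E : normedModType R} (A : {linear E -> E}) :
  continuous A -> exists2 C : R, 0 <= C & forall x, `|A x| <= C * `|x|.
Proof.
move=> /linear_bounded_continuous/linear_boundedP/pinfty_ex_gt0[C C0 hC].
by exists C => //; exact: ltW.
Qed.

Lemma ler0_geometric {R : realType} (q a C : R) :
  0 <= q < 1 -> (forall n, a <= q ^+ n * C) -> a <= 0.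
Proof.
move=> /andP[q0 q1] aq.
have q1' : `|q| < 1 by rewrite ger0_norm.
have h : (fun n => geometric C q n) @ \oo --> (0 : R) := cvg_geometric C q1'.
rewrite -(cvg_lim _ h)//; apply: limr_ge; first by apply/cvg_ex; exists 0.
by near=> n; rewrite /geometric/= mulrC; exact: aq.
Unshelve. all: by end_near. Qed.

(* Neumann iteration: a remainder of half the size is corrected again and again. *)
Lemma approx_decomposition {R : realType} {E : completeNormedModType R}
    (W P : {linear E -> E}) (G : set E) (C : R) :
  continuous W -> continuous P -> 0 <= C ->
  (forall x, G x -> exists u r, [/\ W (x - W u - r) = 0, P u = 0, G r,
     `|r| <= 2^-1 * `|x| & `|u| <= C * `|x|]) ->
  forall x, G x -> exists2 z, P z = 0 & W (x - W z) = 0.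
Proof.
move=> cW cP C0 step x Gx.
have /choice[f fP] : forall x : E, exists p : E * E, G x ->
    [/\ W (x - W p.1 - p.2) = 0, P p.1 = 0, G p.2,
     `|p.2| <= 2^-1 * `|x| & `|p.1| <= C * `|x|].
  move=> y; have [Gy|nGy] := pselect (G y); last by exists (0, 0).
  by have [u [r h]] := step y Gy; exists (u, r).
pose y n := iter n (fun w => (f w).2) x.
have Gy n : G (y n) by elim: n => //= n /fP[].
have yle n : `|y n| <= 2^-1 ^+ n * `|x|.
  elim: n => [|n IH]; first by rewrite expr0 mul1r.
  have [_ _ _ + _] := fP _ (Gy n); move=> /le_trans; apply.
  by rewrite exprS -mulrA ler_pM2l// invr_gt0.
pose u n := (f (y n)).1.
have Pu n : P (u n) = 0 by have [] := fP _ (Gy n).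
have ule n : `|u n| <= C * `|x| * 2^-1 ^+ n.
  have [_ _ _ _] := fP _ (Gy n); move=> /le_trans; apply.
  by rewrite -mulrA ler_wpM2l// mulrC.
have half1 : `|2^-1 : R| < 1 by rewrite ger0_norm ?invr_ge0// invf_lt1// ltr1n.
have cu : cvgn (series u).
  apply: normed_cvg; apply: series_le_cvg (@is_cvg_geometric_series _ (C * `|x|) _ half1).
  - by move=> n; exact: normr_ge0.
  - by move=> n; rewrite /geometric/= !mulr_ge0// exprn_ge0// invr_ge0.
  - exact: ule.
have Pser n : P (series u n) = 0.
  by rewrite /series/= linear_sum big1.
(* Invariant of the iteration: under [W], what the partial sum leaves uncorrected agrees with the
   current remainder [y n], which tends to 0. *)
have Wser n : W (x - W (series u n)) = W (y n).
  elim: n => [|n IH]; first by rewrite /series/= big_nil linear0 subr0.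
  have -> : x - W (series u n.+1) = x - W (series u n) - W (u n).
    by rewrite seriesSr [W (_ + _)]linearD opprD addrA.
  rewrite linearB IH -linearB; apply/eqP; rewrite -subr_eq0 -linearB; apply/eqP.
  by have [] := fP _ (Gy n).
set z := limn (series u); have uz : series u @ \oo --> z by [].
have y0 : y n @[n --> \oo] --> 0.
  apply/norm_cvg0P.
  apply: (@squeeze_cvgr _ _ _ _ (cst 0) (geometric `|x| 2^-1)).
  - by near=> n; rewrite normr_ge0/= mulrC; exact: yle.
  - exact: cvg_cst.
  - exact: cvg_geometric.
exists z.
  have h : P (series u n) @[n --> \oo] --> P z.
    by apply: continuous_cvg; [exact: cP|exact: uz].
  apply: (cvg_unique _ h) => //.
  by rewrite (_ : (fun n => _) = cst 0); [exact: cvg_cst|apply/funext].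
have h : W (x - W (series u n)) @[n --> \oo] --> W (x - W z).
  apply: continuous_cvg; first exact: cW.
  apply: cvgB; first exact: cvg_cst.
  by apply: continuous_cvg; [exact: cW|exact: uz].
apply: (cvg_unique _ h) => //.
rewrite (_ : (fun n => _) = W \o y); last exact/funext.
by rewrite -(linear0 W); apply: continuous_cvg; [exact: cW|exact: y0].
Unshelve. all: by end_near. Qed.

(** * Diophantine approximation of multiples of [a] modulo [b] *)

(** Euclid with nearest rounding: if [v] is the current difference, the integer [q] nearest to
    [b / |v|] makes [q * |v|] differ from [b] by at most [|v| / 2], which halves the bound. *)
Lemma dist_multiples_small {R : realType} (a b : R) (k : nat) : 0 < a -> 0 < b ->
  exists j l : nat, (0 < j)%N /\ `|j%:R * a - l%:R * b| <= b / 2 ^+ k.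
Proof.
move=> a0 b0; elim: k => [|k [j [l [j0 IH]]]].
  have ab0 : 0 <= a / b by rewrite divr_ge0// ltW.
  exists 1%N, (Num.truncn (a / b)); split => //.
  have /andP[h1 h2] := Num.Theory.truncn_itv ab0.
  move: h1 h2; rewrite ler_pdivlMr// ltr_pdivrMr// -natr1 expr0 divr1 mul1r => h1 h2.
  rewrite ler_norml; apply/andP; split; nra.
set v := _ - _ in IH.
have [v0|v0] := eqVneq v 0.
  exists j, l; split => //; rewrite -/v v0 normr0 divr_ge0 ?ltW// exprn_gt0//.
have d0 : 0 < `|v| by rewrite normr_gt0.
have db : `|v| <= b.
  apply: le_trans IH _; rewrite ler_pdivrMr ?exprn_gt0// ler_peMr ?(ltW b0)//.
  by rewrite exprn_ege1// ler1n.
pose q0 := Num.truncn (b / `|v|).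
have bd0 : 0 <= b / `|v| by rewrite divr_ge0// ltW.
have /andP[] := Num.Theory.truncn_itv bd0.
rewrite -/q0 ler_pdivlMr// ltr_pdivrMr// -natr1 mulrDl mul1r => q1 q2.
have q00 : (0 < q0)%N by rewrite truncn_gt0 ler_pdivlMr// mul1r.
have [q [qpos qv]] : exists q : nat, (0 < q)%N /\ `|q%:R * `|v| - b| <= `|v| / 2.
  have [h|h] := lerP (b - q0%:R * `|v|) (`|v| / 2).
    by exists q0; split => //; rewrite ler_norml; apply/andP; split; lra.
  by exists q0.+1; split => //; rewrite -natr1 ler_norml; apply/andP; split; lra.
have le2 : `|v| / 2 <= b / 2 ^+ k.+1.
  by rewrite exprS invfM (mulrC 2^-1) mulrA ler_pM2r ?invr_gt0.
have [vpos|vneg] := lerP 0 v.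
  exists (q * j)%N, (q * l).+1; split; first by rewrite muln_gt0 qpos.
  apply: le_trans le2; apply: le_trans qv.
  rewrite (ger0_norm vpos) -natr1 !natrM /v.
  by rewrite mulrDl mul1r mulrBr !mulrA opprD addrA.
(* For negative [v] one multiple of [b] is given back, so [.-1] must not truncate: [l = 0] would
   make [v] nonnegative. *)
have l0 : (0 < q * l)%N.
  rewrite muln_gt0 qpos/= lt0n; apply: contraTneq vneg => l0.
  by rewrite -leNgt /v l0 mul0r subr0 mulr_ge0// ltW.
exists (q * j)%N, (q * l).-1; split; first by rewrite muln_gt0 qpos.
apply: le_trans le2; apply: le_trans qv.
have -> : (q * l).-1%:R = q%:R * l%:R - 1 :> R.
  by rewrite -[in RHS]natrM -[in RHS](prednK l0) -natr1 addrK.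
rewrite (ltr0_norm vneg) -[in leRHS]normrN natrM /v.
by rewrite mulrN opprB opprK mulrBr mulrBl mul1r !mulrA opprB addrCA addrC.
Qed.

(** A nonzero difference [v] shorter than [e] is repeated: if positive, its multiples climb to [h];
    if negative, they descend from [b] to [h]. *)
Lemma multiples_dense {R : realType} (a b h e : R) : 0 < a -> 0 < h -> h < b -> 0 < e ->
  (exists j l : nat, (0 < j)%N /\ j%:R * a = l%:R * b) \/
  (exists j l : nat, (0 < j)%N /\ `|j%:R * a - l%:R * b - h| < e).
Proof.
move=> a0 h0 hb e0; have b0 : 0 < b by lra.
(* [e] gives the accuracy; [h] and [b - h] ensure that at least one copy of [v] fits, so the
   multiplier is positive. *)
pose m := Num.min e (Num.min h (b - h)).
have m0 : 0 < m by rewrite !lt_min e0 h0/= subr_gt0.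
have [k hk] : exists k, b / 2 ^+ k < m.
  exists (Num.truncn (b / m)).+1; rewrite ltr_pdivrMr ?exprn_gt0// mulrC -ltr_pdivrMr//.
  apply: lt_trans (truncnS_gt _) _.
  by rewrite -natrX ltr_nat ltn_expl.
have [j [l [j0 hv]]] := dist_multiples_small a b k a0 b0.
have := le_lt_trans hv hk; rewrite !lt_min => /and3P[ve vh vbh].
set v := _ - _ in hv ve vh vbh.
have [v0|v0] := eqVneq v 0.
  by left; exists j, l; split => //; apply/eqP; rewrite -subr_eq0 -/v v0.
right; have d0 : 0 < `|v| by rewrite normr_gt0.
have mult c : `|v| < c -> exists r : nat, [/\ (0 < r)%N, r%:R * `|v| <= c & c < r%:R * `|v| + e].
  move=> vc; have c0 : 0 <= c / `|v| by rewrite divr_ge0// (le_trans _ (ltW vc)).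
  have /andP[] := Num.Theory.truncn_itv c0.
  rewrite ler_pdivlMr// ltr_pdivrMr// -natr1 mulrDl mul1r => r1 r2.
  exists (Num.truncn (c / `|v|)); split => //; last by lra.
  by rewrite truncn_gt0 ler_pdivlMr// mul1r ltW.
have [vpos|vneg] := lerP 0 v.
  have [r [r0 r1 r2]] := mult _ vh; exists (r * j)%N, (r * l)%N.
  split; first by rewrite muln_gt0 r0.
  have -> : (r * j)%:R * a - (r * l)%:R * b - h = r%:R * `|v| - h.
    by rewrite ger0_norm// !natrM /v mulrBr !mulrA.
  by rewrite ltr_norml; apply/andP; split; lra.
have [r [r0 r1 r2]] := mult _ vbh.
have l0 : (0 < r * l)%N.
  rewrite muln_gt0 r0/= lt0n; apply: contraTneq vneg => l0.
  by rewrite -leNgt /v l0 mul0r subr0 mulr_ge0// ltW.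
exists (r * j)%N, (r * l).-1; split; first by rewrite muln_gt0 r0.
have -> : (r * l).-1%:R = r%:R * l%:R - 1 :> R.
  by rewrite -[in RHS]natrM -[in RHS](prednK l0) -natr1 addrK.
have -> : (r * j)%:R * a - (r%:R * l%:R - 1) * b - h = b - h - r%:R * `|v|.
  rewrite ltr0_norm// !natrM /v; lra.
by rewrite ltr_norml; apply/andP; split; lra.
Qed.

(** * Semigroup identities and periodic vectors *)

Lemma semigroup_comm {R : realType} {E : normedModType R} (T : R -> {linear E -> E})
    (s t : R) (x : E) :
  C0_semigroup T -> 0 <= s -> 0 <= t -> T s (T t x) = T t (T s x).
Proof. by case=> _ _ TD _ s0 t0; rewrite -!TD// addrC. Qed.

Lemma semigroup_multiple_period {R : realType} {E : normedModType R}
    (T : R -> {linear E -> E}) (n : nat) (b : R) (x : E) :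
  C0_semigroup T -> 0 <= b -> T b x = x -> T (n%:R * b) x = x.
Proof.
case=> _ T0 TD _ b0 Tb; elim: n => [|n IH]; first by rewrite mul0r T0.
by rewrite -natr1 mulrDl mul1r TD// ?mulr_ge0// Tb.
Qed.

Lemma semigroup_telescope {R : realType} {E : normedModType R}
    (T : R -> {linear E -> E}) (k : nat) (c : R) (x : E) :
  C0_semigroup T -> 0 <= c ->
  T c (\sum_(i < k) T (i%:R * c) x) - \sum_(i < k) T (i%:R * c) x =
  T (k%:R * c) x - x.
Proof.
case=> _ T0 TD _ c0; elim: k => [|k IH].
  by rewrite !big_ord0 linear0 mul0r T0 !subrr.
rewrite !big_ord_recr/= linearD opprD addrACA IH -TD ?mulr_ge0//.
by rewrite addrAC addrCA subrr addr0 -[in X in _ = T X _ - _]natr1 mulrDl mul1r [c + _]addrC.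
Qed.

(* Averaging over the finite orbit of x under T(c) projects onto the fixed
   space of T(c), and the rest lies in the range of T(c) - Id. *)
Lemma finite_order_decomposition {R : realType} {E : normedModType R}
    (T : R -> {linear E -> E}) (M : R) (m : nat) (c : R) (x : E) :
  C0_semigroup T -> 0 <= M -> (forall t y, 0 <= t -> `|T t y| <= M * `|y|) ->
  0 <= c -> (0 < m)%N -> T (m%:R * c) x = x ->
  exists u, [/\ T c (x - (T c u - u)) = x - (T c u - u),
    `|u| <= m%:R * M * `|x| & forall e, 0 <= e -> T e x = x -> T e u = u].
Proof.
move=> sT M0 hM c0 m0 Tm.
pose s k : E := \sum_(i < k) T (i%:R * c) x.
have m0R : 0 < m%:R :> R by rewrite ltr0n.
have sle k : (k <= m)%N -> `|s k| <= m%:R * M * `|x|.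
  move=> km; apply: le_trans (ler_norm_sum _ _ _) _.
  apply: le_trans (_ : \sum_(i < k) M * `|x| <= _).
    by apply: ler_sum => i _; apply: hM; rewrite mulr_ge0.
  rewrite sumr_const card_ord -[leLHS]mulr_natl -mulrA ler_wpM2r ?ler_nat//.
  by rewrite mulr_ge0.
(* By telescoping, [T c (s k) - s k = T (k c) x - x]; averaging over [k < m] and changing sign gives
   [T c u - u = x - s m / m], that is, [x] minus its orbit mean. *)
pose u := - (m%:R^-1 *: \sum_(k < m) s k).
have Wu : x - (T c u - u) = m%:R^-1 *: s m.
  have -> : T c u - u = - (m%:R^-1 *: \sum_(k < m) (T c (s k) - s k)).
    by rewrite /u linearN linearZ linear_sum sumrB scalerBr !opprB opprK addrC.
  under eq_bigr do rewrite semigroup_telescope//.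
  rewrite sumrB sumr_const card_ord scalerBr -[x *+ _]scaler_nat scalerA mulVf ?gt_eqF//.
  by rewrite scale1r opprB opprB addrCA subrr addr0.
exists u; split.
- rewrite Wu linearZ/=; congr (_ *: _); apply/eqP; rewrite -subr_eq0.
  by rewrite semigroup_telescope// Tm subrr.
- rewrite /u normrN normrZ ger0_norm ?invr_ge0// mulrC ler_pdivrMr//.
  apply: le_trans (ler_norm_sum _ _ _) _.
  apply: le_trans (_ : \sum_(k < m) m%:R * M * `|x| <= _).
    by apply: ler_sum => i _; apply: sle; exact: ltnW.
  by rewrite sumr_const card_ord -[leLHS]mulr_natr.
- move=> e e0 Te; rewrite /u linearN linearZ linear_sum/=.
  congr (- (_ *: _)); apply: eq_bigr => k _; rewrite linear_sum.
  by apply: eq_bigr => i _; rewrite semigroup_comm ?mulr_ge0// Te.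
Qed.

(* With V = T(s) - Id one has 2V = (T(2s) - Id) - V^2; as |V| <= 1/2 this gives
   |Vx| <= (2/3)|T(2s)x - x|, to be iterated along s, 2s, 4s, ... *)
Lemma fixed_by_small_step {R : realType} {E : normedModType R}
    (T : R -> {linear E -> E}) (M b h : R) (x : E) :
  C0_semigroup T -> (forall t y, 0 <= t -> `|T t y| <= M * `|y|) ->
  0 <= b -> 0 < h ->
  (forall s y, 0 <= s < h -> T b y = y -> `|T s y - y| <= 2^-1 * `|y|) ->
  T b x = x -> T h x = x -> forall s, 0 <= s -> T s x = x.
Proof.
move=> sT hM b0 h0 small Tb Th s s0; have [_ T0 TD _] := sT.
(* Reducing [r] modulo the period [h] extends the estimate from [s < h] to all times. *)
have smallall r y : 0 <= r -> T b y = y -> T h y = y ->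
    `|T r y - y| <= 2^-1 * `|y|.
  move=> r0 Tby Thy; pose k := Num.truncn (r / h).
  have rh0 : 0 <= r / h by rewrite divr_ge0// ltW.
  have /andP[] := Num.Theory.truncn_itv rh0.
  rewrite -/k ler_pdivlMr// ltr_pdivrMr// -natr1 mulrDl mul1r => k1 k2.
  have -> : T r y = T (r - k%:R * h) y.
    rewrite -{2}(semigroup_multiple_period T k h y sT (ltW h0) Thy) -TD ?subrK//.
      by rewrite subr_ge0.
    by rewrite mulr_ge0// ltW.
  by apply: small => //; apply/andP; split; lra.
have half r : 0 <= r -> `|T r x - x| <= 2/3 * `|T (r + r) x - x|.
  move=> r0; pose v := T r x - x.
  have Tbv : T b v = v by rewrite /v linearB (semigroup_comm T b)// Tb.
  have Thv : T h v = v by rewrite /v linearB (semigroup_comm T h r x sT (ltW h0) r0) Th.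
  have -> : T (r + r) x - x = v *+ 2 + (T r v - v).
    by rewrite TD// mulr2n addrACA subrr addr0 /v linearB addrC addrA subrK.
  have := smallall r v r0 Tbv Thv; rewrite -/v => h1.
  (* Here [2|v| <= |T (r + r) x - x| + |T r v - v|], and the last term is at most [|v| / 2]. *)
  have h2 := ler_normB (v *+ 2 + (T r v - v)) (T r v - v).
  rewrite addrK normrMn mulr2n in h2; lra.
have iter n : `|T s x - x| <= (2/3) ^+ n * `|T (2 ^+ n * s) x - x|.
  elim: n => [|n IH]; first by rewrite expr0 !mul1r.
  apply: le_trans IH _; rewrite exprSr -mulrA ler_wpM2l ?exprn_ge0 ?divr_ge0//.
  apply: le_trans (half _ _) _; first by rewrite mulr_ge0 ?exprn_ge0.
  suff -> : 2 ^+ n.+1 * s = 2 ^+ n * s + 2 ^+ n * s by [].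
  by rewrite exprS -mulrA mulr_natl mulr2n.
apply/eqP; rewrite -subr_eq0 -normr_le0.
apply: (@ler0_geometric _ (2/3) _ ((M + 1) * `|x|)); first by apply/andP; split; lra.
move=> n; apply: le_trans (iter n) _; rewrite ler_wpM2l ?exprn_ge0 ?divr_ge0//.
apply: le_trans (ler_normB _ _) _; rewrite mulrDl mul1r lerD2r hM//.
by rewrite mulr_ge0 ?exprn_ge0.
Qed.

(** * Norm continuity and splitting on periodic vectors *)

(** Since [d] is chosen before [x], this is norm continuity at 0 of the restriction to
    [ker (T b - Id)], phrased on vectors to avoid forming the subspace. *)
Definition norm_continuous_on_periodic {R : realType} {E : normedModType R}
    (T : R -> {linear E -> E}) : Prop :=
  forall b e : R, 0 < b -> 0 < e -> exists2 d, 0 < d &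
    forall s x, 0 <= s < d -> T b x = x -> `|T s x - x| <= e * `|x|.

Lemma periodic_decomposition {R : realType} {E : completeNormedModType R}
    (T : R -> {linear E -> E}) (M a b : R) (y : E) :
  C0_semigroup T -> 0 <= M -> (forall t y, 0 <= t -> `|T t y| <= M * `|y|) ->
  norm_continuous_on_periodic T -> 0 < a -> 0 < b -> T b y = y ->
  exists2 z, T b z = z & T a (y - (T a z - z)) = y - (T a z - z).
Proof.
move=> sT M0 hM nc a0 b0 Tby; have [cT T0 TD _] := sT.
have [d1 d10 small] := nc b 2^-1 b0 ltac:(by rewrite invr_gt0).
(* Large enough for [b / m < d1], and at least 2 so that [h < b] strictly. *)
pose m := (Num.truncn (b / d1)).+2.
have m0 : 0 < m%:R :> R by rewrite ltr0n.
pose h := b / m%:R.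
have h0 : 0 < h by rewrite divr_gt0.
have hd1 : h < d1.
  rewrite ltr_pdivrMr// mulrC -ltr_pdivrMr//; apply: lt_trans (truncnS_gt _) _.
  by rewrite ltr_nat.
have hb : h < b by rewrite ltr_pdivrMr// ltr_pMr// ltr1n.
have mh : m%:R * h = b by rewrite mulrC divfK// gt_eqF.
(* [m * M] bounds the averaging vector [v] below and the outer [M] a further [T r]. Then [e] makes
   [c * e <= 1/2]; the [+ 1] in it guards against [c = 0]. *)
pose c := M * (m%:R * M).
have c0 : 0 <= c by rewrite !mulr_ge0// ltW.
pose e := 2^-1 / (c + 1).
have e0 : 0 < e by rewrite divr_gt0 ?invr_gt0 ?ltr_wpDl.
have ce : c * e <= 2^-1.
  by rewrite mulrCA ler_piMr ?invr_ge0// ler_pdivrMr ?ltr_wpDl// mul1r lerDl.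
have [d2 d20 near0] := nc b e b0 e0.
(* [d2] makes the error small in norm; [h] keeps the perturbed time [h + f] positive. *)
have d2h : 0 < Num.min d2 h by rewrite lt_min d20.
have [[j [l [j0 jl]]]|[j [l [j0]]]] := multiples_dense a b h _ a0 h0 hb d2h.
  have [|z [z1 _ z2]] := finite_order_decomposition T M j a y sT M0 hM (ltW a0) j0.
    by rewrite jl (semigroup_multiple_period T l) ?ltW.
  by exists z => //; apply: z2 => //; exact: ltW.
rewrite lt_min => /andP[jl2 jlh].
pose W : {linear E -> E} := (T a \- idfun)%R.
pose P : {linear E -> E} := (T b \- idfun)%R.
have cTB r : 0 <= r -> continuous (T r \- idfun).
  by move=> r0 x; apply: cvgB; [exact: cT|exact: cvg_id].
have a0' := ltW a0; have b0' := ltW b0; have h0' := ltW h0.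
have na0 (n : nat) : 0 <= n%:R * a by rewrite mulr_ge0.
have [| | |x /= Tbx|z Pz Wz] :=
    @approx_decomposition _ _ W P [set x | T b x = x] (j%:R * M * (m%:R * M))
      _ _ _ _ y Tby.
- by apply: cTB; exact: ltW.
- by apply: cTB; exact: ltW.
- by rewrite !mulr_ge0.
- have [|v [v1 v2 v3]] := finite_order_decomposition T M m h x sT M0 hM (ltW h0) isT.
    by rewrite mh.
  have Tbv : T b v = v by apply: v3 => //; exact: ltW.
  (* The sum telescopes to [W u = T (j a) v - v]. Replacing [T (j a)] by [T h] costs exactly the
     remainder, and [x - (T h v - v)] is fixed by [T h], hence by the whole semigroup, so [W] kills
     it. *)
  exists (\sum_(i < j) T (i%:R * a) v), (T h v - T (j%:R * a) v); split.
  + rewrite /W/= semigroup_telescope ?(ltW a0)//.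
    have -> : x - (T (j%:R * a) v - v) - (T h v - T (j%:R * a) v) = x - (T h v - v).
      by rewrite -addrA -opprD [in X in _ - X]addrC addrA subrK.
    apply/eqP; rewrite subr_eq0; apply/eqP.
    apply: (fixed_by_small_step T M b h _ sT hM b0' h0) => //.
      move=> s w /andP[s0 sh]; apply: small; rewrite s0/=; exact: lt_trans hd1.
    by rewrite !linearB Tbx (semigroup_comm T b)// Tbv.
  + rewrite /P/= linear_sum -sumrB big1// => i _.
    by rewrite (semigroup_comm T b)// Tbv subrr.
  + by rewrite linearB !(semigroup_comm T b)// Tbv.
  + pose f := j%:R * a - l%:R * b - h.
    have jaE : T (j%:R * a) v = T (h + f) v.
      have -> : j%:R * a = (h + f) + l%:R * b by rewrite /f; lra.
      rewrite TD ?mulr_ge0//; last first.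
        by move: jlh; rewrite -/f ltr_norml => /andP[]; lra.
      by rewrite (semigroup_multiple_period T l).
    have close r s : 0 <= r -> 0 <= s < d2 -> `|T (r + s) v - T r v| <= 2^-1 * `|x|.
      move=> r0 /andP[s0 sd]; rewrite TD// -linearB; apply: le_trans (hM _ _ r0) _.
      have h1 : `|T s v - v| <= e * `|v| by apply: near0 => //; rewrite s0.
      apply: le_trans (ler_wpM2l M0 h1) _.
      apply: le_trans (_ : M * (e * (m%:R * M * `|x|)) <= _).
        by rewrite ler_wpM2l// ler_wpM2l// ltW.
      have -> : M * (e * (m%:R * M * `|x|)) = c * e * `|x|.
        by rewrite /c; ring.
      by rewrite ler_wpM2r.
    (* The earlier of the times [h] and [h + f] is factored out, whatever the sign of [f]. *)
    rewrite jaE; move: jl2 jlh; rewrite -/f !ltr_norml => /andP[f1 f2] /andP[f3 f4].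
    have [f0|f0] := lerP 0 f.
      by rewrite distrC; apply: close; [exact: ltW|apply/andP].
    have {1}-> : h = (h + f) + (- f) by rewrite addrK.
    by apply: close; [lra|apply/andP; split; lra].
  + apply: le_trans (ler_norm_sum _ _ _) _.
    apply: le_trans (_ : \sum_(i < j) M * (m%:R * M * `|x|) <= _).
      apply: ler_sum => i _; apply: le_trans (hM _ _ _) _ => //.
      by rewrite ler_wpM2l.
    by rewrite sumr_const card_ord -[leLHS]mulr_natl !mulrA.
exists z.
  by apply/eqP; rewrite -subr_eq0; apply/eqP.
by apply/eqP; rewrite -subr_eq0; apply/eqP.
Qed.

(* If T decays exponentially there are no nonzero periodic vectors; otherwise the
   growth bound is 0 and T(kb)x = x transports the estimate at large times to time 0. *)
Lemma norm_continuous_at_infinity_on_periodic {R : realType}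
    {E : completeNormedModType R} (T : R -> {linear E -> E}) :
  C0_semigroup T -> bounded_semigroup T -> norm_continuous_at_infinity T ->
  norm_continuous_on_periodic T.
Proof.
move=> sT [M hM] nc b e b0 e0; have [cT _ _ _] := sT; have b0' := ltW b0.
have leT t x : 0 <= t -> `|T t x| <= opnorm (T t) * `|x|.
  move=> t0; have [C _ hC] := continuous_linear_le (T t) (cT t t0).
  by apply: le_opnorm hC => k y; rewrite linearZ.
have [[w [w0 [N hN]]]|hgb] := pselect (exists w, w < 0 /\ exists N : R,
    forall t, 0 <= t -> opnorm (T t) <= N * expR (w * t)).
  exists 1 => // s x _ Tbx.
  suff -> : x = 0 by rewrite linear0 subrr normr0 mulr0.
  apply/eqP; rewrite -normr_le0.
  apply: (@ler0_geometric _ (expR (w * b)) _ (N * `|x|)).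
    by rewrite expR_ge0/= -expR0 ltr_expR pmulr_llt0.
  move=> n; have nb0 : 0 <= n%:R * b by rewrite mulr_ge0.
  rewrite -{1}(semigroup_multiple_period T n b x sT b0' Tbx).
  apply: le_trans (leT _ x nb0) _; rewrite mulrA ler_wpM2r//.
  apply: le_trans (hN _ nb0) _.
  by rewrite -expRM_natl mulrC mulrCA.
(* Boundedness admits the rate 0, and the excluded case rules out every negative rate. *)
have gb0 : growth_bound T = 0%:E.
  apply/eqP; rewrite eq_le; apply/andP; split.
    apply: ereal_inf_lbound; exists 0 => //=; exists M => t t0.
    by rewrite mul0r expR0 mulr1; exact: hM.
  apply: le_ereal_inf_tmp => _ [w /= wN <-]; rewrite lee_fin leNgt.
  by apply/negP => w0; apply: hgb; exists w.
have [t0 ht0] := nc 0 gb0 e e0.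
pose k := (Num.truncn `|t0 / b|).+1.
have kb : t0 <= k%:R * b.
  rewrite -ler_pdivrMr//; apply: le_trans (ler_norm _) _.
  by apply: ltW; exact: truncnS_gt.
have kb0 : 0 <= k%:R * b by rewrite mulr_ge0.
have [d [d0 hd]] := ht0 _ kb.
exists d => // s x /andP[s0 sd] Tbx.
(* The hypothesis at infinity only speaks of strictly positive increments. *)
have [sE|sn0] := eqVneq s 0.
  by case: sT => _ T0 _ _; rewrite sE T0 subrr normr0 mulr_ge0// ltW.
have spos : 0 < s by rewrite lt_neqAle eq_sym sn0.
pose A y := expR (- 0 * (k%:R * b)) *: T (k%:R * b) (y - expR (- 0 * s) *: T s y).
have AE y : A y = T (k%:R * b) (y - T s y).
  by rewrite /A !oppr0 !mul0r expR0 !scale1r.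
have [C C0 hC] := continuous_linear_le (T (k%:R * b)) (cT _ kb0).
have [D D0 hD] := continuous_linear_le (T s) (cT _ s0).
(* Any finite bound will do: it only gives access to [le_opnorm]. *)
have bnd y : `|A y| <= C * (1 + D) * `|y|.
  rewrite AE; apply: le_trans (hC _) _; rewrite -mulrA ler_wpM2l//.
  by apply: le_trans (ler_normB _ _) _; rewrite mulrDl mul1r lerD2l.
have scA : scalable A by move=> c y; rewrite !AE linearZ -scalerBr linearZ.
have := le_trans (le_opnorm A _ x scA bnd) (ler_wpM2r (normr_ge0 x) (hd s spos sd)).
rewrite AE linearB (semigroup_comm T _ s)//.
by rewrite (semigroup_multiple_period T k b x sT b0' Tbx) distrC.
Qed.

(** * Products of commuting factors and their kernels *)

Lemma foldr_comp_linear {R : realType} {E : normedModType R} {I : Type}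
    (A : I -> {linear E -> E}) (s : seq I) :
  exists L : {linear E -> E}, forall x, foldr (fun i g => A i \o g) id s x = L x.
Proof.
elim: s => [|i s [L hL]]; first by exists idfun.
by exists (A i \o L) => x /=; rewrite hL.
Qed.

Lemma foldr_comp_comm {E I : Type} (A : I -> E -> E) (B : E -> E) (s : seq I) (x : E) :
  (forall i y, A i (B y) = B (A i y)) ->
  foldr (fun i g => A i \o g) id s (B x) = B (foldr (fun i g => A i \o g) id s x).
Proof. by move=> AB; elim: s => //= i s ->. Qed.

(** Commutation moves the factor that kills [x] to the innermost place. *)
Lemma foldr_comp_ker {R : realType} {E : normedModType R} {I : eqType}
    (A : I -> {linear E -> E}) (s : seq I) (i : I) (x : E) :
  (forall i j x, A i (A j x) = A j (A i x)) -> i \in s -> A i x = 0 ->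
  foldr (fun i g => A i \o g) id s x = 0.
Proof.
move=> AA + Ax; elim: s => //= j s IH; rewrite inE => /orP[/eqP <-|/IH ->].
  have [L hL] := foldr_comp_linear A s.
  by rewrite -(foldr_comp_comm A (A i))// Ax hL linear0.
by rewrite linear0.
Qed.

Lemma semigroup_sub_id_comm {R : realType} {E : normedModType R}
    (T : R -> {linear E -> E}) (s t : R) (x : E) :
  C0_semigroup T -> 0 <= s -> 0 <= t ->
  T s (T t x - x) - (T t x - x) = T t (T s x - x) - (T s x - x).
Proof.
move=> sT s0 t0; rewrite [T s (_ - _)]linearB [T t (_ - _)]linearB/=.
by rewrite (semigroup_comm T s)// !opprD !opprK addrACA.
Qed.

(** Stated for a list so that the induction can drop its head. As components are indexed by [I],
    [uniq] lets the head component be set without disturbing the tail. *)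
Lemma ker_prod_decomposition {R : realType} {E : completeNormedModType R}
    {I : eqType} (T : R -> {linear E -> E}) (M : R) (t : I -> R)
    (A := fun i x => T (t i) x - x) (s : seq I) (x : E) :
  C0_semigroup T -> 0 <= M -> (forall t y, 0 <= t -> `|T t y| <= M * `|y|) ->
  norm_continuous_on_periodic T -> (forall i, 0 < t i) -> uniq s ->
  foldr (fun i g => A i \o g) id s x = 0 ->
  exists y : I -> E, (forall i, A i (y i) = 0) /\ x = \sum_(i <- s) y i.
Proof.
move=> sT M0 hM nc t0; elim: s x => [|i s IH] x /=.
  move=> _ ->; exists (fun=> 0); rewrite big_nil; split => // i.
  by rewrite /A linear0 subrr.
move=> /andP[ins us] prod0.
have t0' j : 0 <= t j by exact: ltW.
have AA j y : A j (A i y) = A i (A j y).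
  exact: semigroup_sub_id_comm.
have [|y [yA Axy]] := IH (A i x) us; first by rewrite foldr_comp_comm.
(* Each [y j] equals [A i (z j)] up to a vector killed by [A i]; subtracting all [z j] from [x] thus
   gives [A i (A i w) = 0]. *)
have /choice[z hz] : forall j, exists z, A j z = 0 /\ A i (y j - A i z) = 0.
  move=> j; have /eqP := yA j; rewrite subr_eq0 => /eqP Ty.
  have [z z1 z2] := periodic_decomposition T M (t i) (t j) (y j) sT M0 hM nc (t0 i) (t0 j) Ty.
  by exists z; rewrite /A z1 subrr z2 subrr.
pose w := x - \sum_(j <- s) z j.
have AiD u v : A i (u - v) = A i u - A i v.
  by rewrite /A [T _ (_ - _)]linearB !opprD !opprK addrACA.
have AiS (f : I -> E) : A i (\sum_(j <- s) f j) = \sum_(j <- s) A i (f j).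
  by rewrite /A linear_sum sumrB.
have AAw : A i (A i w) = 0.
  rewrite /w (AiD x) AiS Axy -sumrB AiS big1// => j _; by have [] := hz j.
(* T(t_i)^n w = w + n A w grows linearly unless A w = 0. *)
have Aw : A i w = 0.
  have Tn (n : nat) : T (n%:R * t i) w = w + n%:R *: A i w.
    have /eqP := AAw; rewrite subr_eq0 => /eqP TA.
    elim: n => [|n IHn].
      by rewrite mul0r scale0r addr0; case: sT.
    case: (sT) => _ _ TD _.
    rewrite -natr1 mulrDl mul1r addrC TD ?mulr_ge0// IHn linearD linearZ/= TA.
    have -> : T (t i) w = w + A i w by rewrite /A addrC subrK.
    by rewrite scalerDl scale1r -addrA [X in w + X]addrC.
  apply/eqP; rewrite -normr_le0 leNgt; apply/negP => Apos.
  (* Threshold beyond which [n * |A i w|] exceeds the bound [(M + 1) * |w|] on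
     [|T (n t_i) w - w|]. *)
  pose c := (M + 1) * `|w| / `|A i w|.
  have c0 : 0 <= c by rewrite divr_ge0 ?mulr_ge0 ?addr_ge0.
  have /negP := truncnS_gt c; apply; apply/negP; rewrite -leNgt ler_pdivlMr//.
  set n := _.+1.
  have -> : n%:R * `|A i w| = `|T (n%:R * t i) w - w|.
    by rewrite Tn addrC addKr normrZ ger0_norm.
  apply: le_trans (ler_normB _ _) _; rewrite mulrDl mul1r lerD2r hM//.
  by rewrite mulr_ge0.
exists (fun j => if j == i then w else z j); split.
  by move=> j; case: eqP => [->//|_]; have [] := hz j.
rewrite big_cons eqxx big_seq (eq_bigr z); first by rewrite -big_seq subrK.
by move=> j js; case: eqP => // ji; rewrite -ji js in ins.
Qed.

Theorem theorem2p14 (R : realType) (E : completeNormedModType R)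
    (T : R -> {linear E -> E}) :
  C0_semigroup T -> bounded_semigroup T -> norm_continuous_at_infinity T ->
  forall (n : nat) (t : 'I_n -> R), (forall i, 0 <= t i) ->
    kerset (opprod (fun i x => T (t i) x - x)) =
    sumsets (fun i => kerset (fun x => T (t i) x - x)).
Proof.
move=> sT bT nc n t t0; have [cT T0 TD _] := sT.
apply/seteqP; split => x; rewrite /kerset /sumsets /opprod /=; last first.
  move=> [y [yker ->]].
  pose A i : {linear E -> E} := (T (t i) \- idfun)%R.
  have AA i j v : A i (A j v) = A j (A i v).
    exact: semigroup_sub_id_comm.
  have [L hL] := foldr_comp_linear A (enum 'I_n).
  change (foldr (fun i g => A i \o g) id (enum 'I_n) (\sum_(i < n) y i) = 0).
  rewrite hL linear_sum big1// => i _; rewrite -hL.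
  by apply: (foldr_comp_ker A _ i); rewrite ?mem_enum//; exact: yker.
(* If some [t i] is 0, its kernel is all of [E] and takes [x] whole; otherwise all times are
   positive. *)
have [[i ti0]|tpos] := pselect (exists i, t i = 0).
  move=> _; exists (fun j => if j == i then x else 0); split.
    by move=> j; case: eqP => [->|_]; rewrite ?ti0 ?T0 ?subrr// linear0 subrr.
  by rewrite -big_mkcond big_pred1_eq.
have [M hM] := bT.
have leT s v : 0 <= s -> `|T s v| <= `|M| * `|v|.
  move=> s0; have [C _ hC] := continuous_linear_le (T s) (cT s s0).
  have /le_trans := le_opnorm (T s) C v (fun k y => linearZ _ _) hC; apply.
  by rewrite ler_wpM2r// (le_trans (hM s s0))// ler_norm.
move=> xker; have [| | |y [yker ->]] :=
  ker_prod_decomposition T `|M| t (enum 'I_n) x sT (normr_ge0 M) leT _ _ _ xker.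
- exact: norm_continuous_at_infinity_on_periodic.
- by move=> i; rewrite lt_neqAle t0 andbT eq_sym; apply/eqP => ti; apply: tpos; exists i.
- exact: enum_uniq.
by exists y; split => //; rewrite big_enum.
Qed.
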